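(* Let $X$ be a normal topological space and let $A$ be a closed subset of $X$ with empty interior such that each point of $A$ has a countable basis of neighbourhoods in $X$. If $X\setminus A$, equipped with the ls-structure $LS(X,A)$ and the topology induced from $X$, is an hls-space, then it is hls-normal.
   Context: For $B\subseteq X$ and a family $\mathcal{U}$ of subsets of $X$, $\mathrm{st}(B,\mathcal{U})$ is the union of the elements of $\mathcal{U}$ meeting $B$; for a family $\mathcal{B}$, $\mathrm{st}(\mathcal{B},\mathcal{U})=\{\mathrm{st}(B,\mathcal{U})\mid B\in\mathcal{B}\}$. A large scale structure (ls-structure) on a set $X$ is a nonempty collection $\mathcal{L}$ of families of subsets of $X$ (the uniformly bounded families) such that: (i) if $\mathcal{B}_1\in\mathcal{L}$ and each element of $\mathcal{B}_2$ having more than one point is contained in some element of $\mathcal{B}_1$, then $\mathcal{B}_2\in\mathcal{L}$; (ii) $\mathcal{B}_1,\mathcal{B}_2\in\mathcal{L}$ implies $\mathrm{st}(\mathcal{B}_1,\mathcal{B}_2)\in\mathcal{L}$. A hybrid large scale space (hls-space) is a set with an ls-structure and a topology such that some uniformly bounded cover consists of open sets. For a closed subset $A$ with empty interior of a topological space $X$, the ls-structure $LS(X,A)$ on $X\setminus A$ is: a family $\mathcal{U}$ of subsets of $X\setminus A$ is in $LS(X,A)$ if and only if for each $a\in A$ and each open neighbourhood $U$ of $a$ in $X$ there is an open neighbourhood $V\subseteq U$ of $a$ such that $W\in\mathcal{U}$ and $W\cap V\neq\varnothing$ imply $W\subseteq U$. A subset is bounded if it is an element of some uniformly bounded cover. The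 coarse component of a point $x$ is the union of all bounded sets containing $x$. A subset is weakly bounded if its intersection with every coarse component is bounded. $N$ is a coarse neighbourhood of $A$ if $A\subseteq N$ and for every uniformly bounded cover $\mathcal{U}$, $\mathrm{st}(A,\mathcal{U})\subseteq N\cup K$ for some weakly bounded $K$. $N$ is a topological neighbourhood of $A$ if $N$ contains an open set containing $\mathrm{cl}(A)$. $N$ is a hybrid neighbourhood of $A$ if it is both. An hls-space $X$ is hls-normal if for every closed $A\subseteq X$ and every hybrid neighbourhood $N$ of $A$ there is a closed $V\subseteq X$ such that $V$ is a hybrid neighbourhood of $A$ and $N$ is a hybrid neighbourhood of $V$. *)

(* Defs.v *)
From HB Require Import structures.
From mathcomp Require Import all_boot all_order.
From mathcomp Require Import all_classical topology.

Set Implicit Arguments.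
Unset Strict Implicit.
Unset Printing Implicit Defensive.

Local Open Scope classical_set_scope.

Definition star {T : Type} (B : set T) (U : set (set T)) : set T :=
  \bigcup_(W in [set W | U W /\ W `&` B !=set0]) W.

Definition family_star {T : Type} (BB U : set (set T)) : set (set T) :=
  [set star B U | B in BB].

Record ls_structure (T : Type) := LsStructure {
  unif_bounded : set (set (set T));
  ls_nonempty : unif_bounded !=set0;
  ls_refine : forall B1 B2 : set (set T), unif_bounded B1 ->
    (forall B, B2 B -> (exists x y, [/\ B x, B y & x <> y]) ->
       exists2 C, B1 C & B `<=` C) ->
    unif_bounded B2;
  ls_star : forall B1 B2 : set (set T), unif_bounded B1 -> unif_bounded B2 ->
    unif_bounded (family_star B1 B2) }.

Section coarse_notions.
Context {T : Type} (L : ls_structure T).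

Definition unif_bounded_cover (U : set (set T)) : Prop :=
  unif_bounded L U /\ \bigcup_(W in U) W = setT.

Definition ls_bounded (B : set T) : Prop := exists2 U, unif_bounded_cover U & U B.

Definition coarse_component (x : T) : set T :=
  \bigcup_(B in [set B | ls_bounded B /\ B x]) B.

Definition weakly_bounded (K : set T) : Prop :=
  forall x, ls_bounded (K `&` coarse_component x).

Definition coarse_neighbourhood (A N : set T) : Prop :=
  A `<=` N /\
  forall U, unif_bounded_cover U ->
    exists2 K, weakly_bounded K & star A U `<=` N `|` K.

End coarse_notions.

Definition topological_neighbourhood {T : topologicalType} (A N : set T) :
    Prop :=
  exists O : set T, [/\ open O, closure A `<=` O & O `<=` N].

Section hybrid_notions.
Context {T : topologicalType} (L : ls_structure T).

Definition is_hls_space : Prop :=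
  exists2 U, unif_bounded_cover L U & forall W, U W -> open W.

Definition hybrid_neighbourhood (A N : set T) : Prop :=
  coarse_neighbourhood L A N /\ topological_neighbourhood A N.

Definition hls_normal : Prop :=
  forall A N : set T, closed A -> hybrid_neighbourhood A N ->
    exists V : set T,
      [/\ closed V, hybrid_neighbourhood A V & hybrid_neighbourhood V N].

End hybrid_notions.

Section LS.
Context {X : topologicalType} (A : set X).

(* X \ A is the subtype set_type (~` A), which the library equips with the
   topology induced from X; its subsets are compared with subsets of X through
   their image under the inclusion set_val. *)
Definition LS_family (UU : set (set (set_type (~` A)))) : Prop :=
  forall a, A a -> forall U : set X, open U -> U a ->
  exists V : set X, [/\ open V, V a, V `<=` U &
    forall W, UU W -> (set_val @` W) `&` V !=set0 -> set_val @` W `<=` U].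

Lemma LS_nonempty : LS_family !=set0.
Proof. by exists set0 => a Aa U oU Ua; exists U; split. Qed.

Lemma LS_refine B1 B2 : LS_family B1 ->
  (forall B, B2 B -> (exists x y, [/\ B x, B y & x <> y]) ->
     exists2 C, B1 C & B `<=` C) ->
  LS_family B2.
Proof.
move=> LB1 B12 a Aa U oU Ua.
have [V [oV Va VU HV]] := LB1 a Aa U oU Ua.
exists V; split => // W B2W [_ [[w Ww <-] Vw]] _ [z Wz <-].
have [->|wz] := pselect (z = w); first exact: VU.
have [|C B1C WC] := B12 _ B2W; first by exists z, w.
apply: (HV C B1C); last by exists z => //; exact: WC.
by exists (set_val w); split => //; exists w => //; exact: WC.
Qed.

Lemma LS_star B1 B2 : LS_family B1 -> LS_family B2 ->
  LS_family (family_star B1 B2).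
Proof.
move=> LB1 LB2 a Aa U oU Ua.
have [V1 [oV1 V1a V1U H1]] := LB2 a Aa U oU Ua.
have [V2 [oV2 V2a V21 H2]] := LB1 a Aa V1 oV1 V1a.
have [V3 [oV3 V3a V32 H3]] := LB2 a Aa V2 oV2 V2a.
exists V3; split => //; first by move=> x /V32/V21/V1U.
move=> _ [B B1B <-] [_ [[w [C [B2C [c [Cc Bc]]] Cw] <-] V3w]].
have CV2 : set_val @` C `<=` V2.
  by apply: H3 => //; exists (set_val w); split => //; exists w.
have BV1 : set_val @` B `<=` V1.
  apply: H2 => //; exists (set_val c); split; first by exists c.
  by apply: CV2; exists c.
move=> _ [z [D [B2D [d [Dd Bd]]] Dz] <-].
apply: (H1 D B2D); last by exists z.
by exists (set_val d); split; [exists d|apply: BV1; exists d].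
Qed.

Definition LS : ls_structure (set_type (~` A)) :=
  LsStructure LS_nonempty LS_refine LS_star.

End LS.

Definition countable_nbhs_basis {X : topologicalType} (a : X) : Prop :=
  exists B : set (set X), [/\ countable B, forall V, B V -> nbhs a V &
    forall U, nbhs a U -> exists2 V, B V & V `<=` U].

(* Main.v *)
(* In X \ A with the structure LS(X, A), the bounded sets are those whose
   closure in X misses A, and any two points are jointly bounded, so "weakly
   bounded" and "bounded" agree.  If closures (in X) of B and of the complement
   of N had a common point a in A, then sequences b_n, c_n in these two sets
   converging to a would give a uniformly bounded family {b_n, c_n} whose star
   carries B to points of the complement of N accumulating at a.  Hence N is a
   hybrid neighbourhood of B exactly when B and the complement of N have
   disjoint closures in X, and hls-normality is read off normality of X. *)
Require Import Defs.
From mathcomp Require Import all_boot all_order.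
From mathcomp Require Import all_classical topology.

Local Open Scope classical_set_scope.

(** Finite intersections of an enumerated basis are decreasing, so sequences chosen from them
    converge to [a]. *)
Lemma countable_nbhs_basis_seq (X : topologicalType) (a : X) :
  countable_nbhs_basis a ->
  exists g : nat -> set X, (forall n, nbhs a (g n)) /\
    forall U, nbhs a U -> exists m, forall n, m <= n -> g n `<=` U.
Proof.
move=> [B [/countable_injP [f finj] Bnbhs Bbasis]].
(* A number [k] that codes no basis element gets [setT], harmless in an intersection. *)
pose e k := xget setT [set V | B V /\ f V = k].
have nbhs_e k : nbhs a (e k).
  rewrite /e; case: xgetP => [V _ [BV _]|_]; [exact: Bnbhs|exact: filterT].
exists (fun n => \big[setI/setT]_(k < n.+1) e k); split.
  by move=> n; elim/big_ind: _ => //; [exact: filterT|move=> P Q; exact: filterI].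
move=> U /Bbasis [V BV VU]; exists (f V) => n fVn x.
rewrite -(bigcap_mkord n.+1 e) => /(_ (f V) fVn).
rewrite /e; case: xgetP => [W _ [BW fWV]|/(_ V)]; last by case.
by rewrite (finj W V) ?inE //; exact: VU.
Qed.

(** The refinement axiom ignores one-point sets, so singletons can be added to turn a family into a
    cover. *)
Lemma unif_bounded_coverU1 (T : Type) (L : ls_structure T) (U : set (set T)) :
  unif_bounded L U -> unif_bounded_cover L (U `|` range set1).
Proof.
move=> LU; split; last first.
  by rewrite -subTset => x _; exists [set x] => //; right; exists x.
apply: (ls_refine LU) => B [UB _|[x _ <-] [y [z [-> -> //]]]].
by exists B.
Qed.

Lemma ls_boundedP (T : Type) (L : ls_structure T) (B : set T) :
  ls_bounded L B <-> unif_bounded L [set B].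
Proof.
split=> [[U [LU _] UB]|LB].
  by apply: (ls_refine LU) => _ -> _; exists B.
by exists ([set B] `|` range set1); [exact: unif_bounded_coverU1|left].
Qed.

Section LS_hybrid.
Context (X : topologicalType) (A : set X).
Hypothesis T1X : accessible_space X.
Local Notation Y := (set_type (~` A)).
Implicit Types B N K : set Y.
Local Notation cl B := (closure (set_val @` B)).

Lemma set_val_notin (y : Y) : ~ A (set_val y).
Proof. exact: (set_valP y). Qed.

Lemma ls_bounded_LS B : ls_bounded (LS A) B <-> cl B `&` A = set0.
Proof.
rewrite ls_boundedP; split=> [LB|BA a Aa U oU Ua].
  rewrite -subset0 => a [clBa Aa].
  have [_ [[b Bb <-] _]] := clBa _ filterT.
  (* If [B] accumulated at [a], this neighbourhood of [a] would have to contain all of [B],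
     including [b]. *)
  have ob : open (~` [set set_val b]).
    by apply: closed_openC; exact: accessible_closed_set1.
  have [|V [oV Va _ /(_ B erefl) VB]] := LB a Aa _ ob.
    by move=> ab; apply: (set_val_notin b); rewrite -ab.
  by apply: VB; [exact: clBa (open_nbhs_nbhs (conj oV Va))|exists b|].
(* This neighbourhood misses [B], so the condition on members meeting it is vacuous. *)
exists (U `&` ~` cl B); split=> //.
- by apply: openI => //; exact/closed_openC/closed_closure.
- by split=> // clBa; suff: set0 a by []; rewrite -BA.
- by move=> _ -> [x [Bx [_ []]]]; exact: subset_closure.
Qed.

Lemma coarse_component_LS (x : Y) : coarse_component (LS A) x = setT.
Proof.
rewrite -subTset => y _; exists [set x; y]; last by right.
split; last by left.
apply/ls_bounded_LS; rewrite image_setU !image_set1.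
have /accessible_finite_set_closed/(_ [set set_val x; set_val y]) := T1X.
rewrite finite_setU => /(_ (conj (finite_set1 _) (finite_set1 _))).
move=> /closure_id <-; rewrite -subset0 => z [[->|->]]; exact: set_val_notin.
Qed.

Lemma weakly_bounded_LS K : weakly_bounded (LS A) K <-> cl K `&` A = set0.
Proof.
split=> [wK|KA x]; last by rewrite coarse_component_LS setIT ls_bounded_LS.
rewrite -subset0 => a [clKa Aa]; have [_ [[k Kk _] _]] := clKa _ filterT.
have := wK k; rewrite coarse_component_LS setIT ls_bounded_LS => KA.
by rewrite -KA.
Qed.

(** If [a] is off [cl B], members of [U] coming close to [a] stay in the complement of [cl B], so
    none of them contributes to the star. *)
Lemma star_LS_closure B (U : set (set Y)) (a : X) :
  unif_bounded (LS A) U -> A a -> cl (star B U) a -> cl B a.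
Proof.
move=> LU Aa sa; apply: contrapT => nBa.
have oB : open (~` cl B) by exact/closed_openC/closed_closure.
have [V [oV Va _ VB]] := LU a Aa _ oB nBa.
have [_ [[x [W [UW [w [Ww Bw]]] Wx] <-] Vx]] := sa V (open_nbhs_nbhs (conj oV Va)).
have /(_ (set_val w)) : set_val @` W `<=` ~` cl B.
  by apply: VB => //; exists (set_val x); split=> //; exists x.
by case; [exists w|apply: subset_closure; exists w].
Qed.

Lemma LS_converging_pairs (b c : nat -> Y) (a : X) :
  normal_space X -> A a ->
  (forall U, nbhs a U -> exists m, forall n, m <= n ->
     U (set_val (b n)) /\ U (set_val (c n))) ->
  unif_bounded (LS A) (range (fun n => [set b n; c n])).
Proof.
move=> normalX Aa bca a' Aa' U oU Ua'.
(* [O] handles the tail of the sequence. At [a' = a] convergence gives it; at any other [a'],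
   normality gives an [O] that the tail avoids. *)
have [O [m [oO Oa' Om]]] : exists O m, [/\ open O, O a' & forall n, m <= n ->
    O (set_val (b n)) \/ O (set_val (c n)) ->
    U (set_val (b n)) /\ U (set_val (c n))].
  have [aa'|/eqP aa'] := eqVneq a a'.
    have [|m bcm] := bca U; first by apply: open_nbhs_nbhs; rewrite aa'.
    by exists U, m; split=> // n /bcm.
  have cla := accessible_closed_set1 T1X.
  have : set_nbhs [set a] (~` [set a']).
    apply/set_nbhsP; exists (~` [set a']); split=> //.
      exact: closed_openC (cla _).
    by move=> _ ->.
  move=> /(normalX _ (cla a)) [M /(_ a erefl) Ma Ma'].
  have [m bcm] := bca M Ma; exists (~` closure M), m; split.
  - exact/closed_openC/closed_closure.
  - by move=> /Ma'; apply.
  - by move=> n /bcm [/subset_closure Mb /subset_closure Mc] [].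
(* The finitely many pairs before [m] are cut away; their points lie outside [A], so [a']
   survives. *)
pose F := [set set_val (b n) | n in `I_m] `|` [set set_val (c n) | n in `I_m].
have clF : closed F.
  move/accessible_finite_set_closed: T1X; apply.
  by rewrite finite_setU; split; exact: finite_image (finite_II m).
exists ((U `&` O) `&` ~` F); split.
- by apply: openI; [exact: openI|exact: closed_openC].
- by split=> // -[[n _ an]|[n _ an]]; [apply: (set_val_notin (b n))|
    apply: (set_val_notin (c n))]; rewrite an.
- by move=> x [[]].
move=> _ [n _ <-] [_ [[x bcx <-] [[Ux Ox] nFx]]].
have [nm|mn] := ltnP n m.
  by case: nFx; case: bcx => ->; [left|right]; exists n.
have [|Ub Uc] := Om n mn; first by case: bcx => <-; [left|right].
by move=> _ [z [->|->] <-].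
Qed.

Hypothesis normalX : normal_space X.
Hypothesis basisA : forall a : X, A a -> countable_nbhs_basis a.

Lemma coarse_neighbourhood_LS B N : coarse_neighbourhood (LS A) B N <->
  B `<=` N /\ cl B `&` cl (~` N) `&` A = set0.
Proof.
split=> [[BN HN]|[BN BNA]]; split=> //.
  rewrite -subset0 => a [[Ba Na] Aa].
  have [g [nbhs_g g_basis]] := countable_nbhs_basis_seq _ _ (basisA _ Aa).
  have /choice [p Hp] : forall n, exists p : Y * Y,
      [/\ B p.1, g n (set_val p.1), ~ N p.2 & g n (set_val p.2)].
    move=> n; have [_ [[y By <-] gy]] := Ba _ (nbhs_g n).
    have [_ [[z Nz <-] gz]] := Na _ (nbhs_g n).
    by exists (y, z).
  pose b n := (p n).1; pose c n := (p n).2.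
  have bca U : nbhs a U -> exists m, forall n, m <= n ->
      U (set_val (b n)) /\ U (set_val (c n)).
    move=> /g_basis [m gU]; exists m => n mn.
    by have [_ gb _ gc] := Hp n; split; apply: gU mn _ _.
  have := unif_bounded_coverU1 _ _ _ (LS_converging_pairs _ _ _ normalX Aa bca).
  move=> /HN [K /weakly_bounded_LS KA starK].
  suff Ka : cl K a by rewrite -KA.
  move=> U /bca [m /(_ m (leqnn m)) [_ Uc]].
  exists (set_val (c m)); split=> //; exists (c m) => //.
  have [Bb _ nNc _] := Hp m; case: (starK (c m)) => //.
  exists [set b m; c m]; last by right.
  by split; [left; exists m|exists (b m); split=> //; left].
move=> U [LU _]; exists (star B U `\` N); last first.
  by move=> y sy; have [|] := pselect (N y); [left|right].
apply/weakly_bounded_LS; rewrite -subset0 => a [sNa Aa].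
rewrite -BNA; split=> //; split.
  by apply: star_LS_closure LU Aa _; apply: closure_subset sNa;
    apply: image_subset => y [].
by apply: closure_subset sNa; apply: image_subset => y [].
Qed.

Lemma closure_LS_val B (y : Y) : closure B y <-> cl B (set_val y).
Proof.
split=> [By U|By U].
  rewrite nbhsE => -[O [oO Oy] OU].
  have [|z [Bz Oz]] := By (set_val @^-1` O).
    by apply: open_nbhs_nbhs; split=> //; exists O.
  by exists (set_val z); split; [exists z|exact: OU].
rewrite nbhsE => -[_ [[O oO <-] Oy] OU].
have [_ [[z Bz <-] Oz]] := By O (open_nbhs_nbhs (conj oO Oy)).
by exists z; split=> //; exact: OU.
Qed.

Lemma topological_neighbourhood_LS B N : topological_neighbourhood B N <->
  cl B `&` cl (~` N) `<=` A.
Proof.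
split=> [[O [oO BO ON]] x [Bx Nx]|BNA].
  apply: contrapT => nAx.
  have [y xy] : exists y : Y, set_val y = x.
    by exists (SigSub (mem_set (nAx : (~` A) x))).
  move: Bx Nx; rewrite -xy -!closure_LS_val => /BO Oy.
  by rewrite closure_setC; apply; exists O.
exists N^°; split; [exact: open_interior| |exact: interior_subset].
move=> y /closure_LS_val By; apply: contrapT => Ny.
by apply: (set_val_notin y); apply: BNA; split=> //;
  rewrite -closure_LS_val closure_setC.
Qed.

Lemma hybrid_neighbourhood_LS B N : hybrid_neighbourhood (LS A) B N <->
  cl B `&` cl (~` N) = set0.
Proof.
rewrite /hybrid_neighbourhood coarse_neighbourhood_LS.
rewrite topological_neighbourhood_LS; split.
  by move=> [[_ BNA] /setIidPl <-].
move=> BN; rewrite BN set0I; do !split=> //.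
move=> y By; apply: contrapT => Ny.
suff: set0 (set_val y) by [].
by rewrite -BN; split; apply: subset_closure; exists y.
Qed.

End LS_hybrid.

Theorem corollary10p6 (X : topologicalType) (A : set X)
  (T1X : accessible_space X) (normalX : normal_space X)
  (closedA : closed A) (interiorA : interior A = set0)
  (basisA : forall a : X, A a -> countable_nbhs_basis a)
  (hlsXA : is_hls_space (LS A)) :
  hls_normal (LS A).
Proof.
move=> B N _ /hybrid_neighbourhood_LS BN.
have {}BN := BN T1X normalX basisA.
set clB := closure _ in BN; set clN := closure _ in BN.
have : set_nbhs clB (~` clN).
  apply/set_nbhsP; exists (~` clN); split=> //.
    exact/closed_openC/closed_closure.
  by apply/disjoints_subset.
move=> /(normalX _ (@closed_closure _ _)) [M /set_nbhsP [O [oO BO OM]] MN].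
(* The trace of [closure M] is closed. Its complement misses the open set [O] around [clB], and its
   closure in [X] stays in [closure M], away from [clN]. *)
pose V : set (set_type (~` A)) := set_val @^-1` closure M.
have clVM : closure (set_val @` V) `<=` closure M.
  rewrite [closure M](closure_id _).1; last exact: closed_closure.
  by apply: closure_subset => _ [y Vy <-].
exists V; split.
- rewrite -openC; exists (~` closure M) => //.
  exact/closed_openC/closed_closure.
- apply/hybrid_neighbourhood_LS => //; apply/disjoints_subset.
  apply: subset_trans BO _ => x Ox Vx.
  have [_ [[y nVy <-] Oy]] := Vx O (open_nbhs_nbhs (conj oO Ox)).
  by apply: nVy; apply: subset_closure; exact: OM.
- apply/hybrid_neighbourhood_LS => //; apply/disjoints_subset.
  exact: subset_trans clVM MN.
Qed.
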